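(* Let $R$ be a semiring which lacks zero sums. Then any indecomposable projective $R$-module $P$ is isomorphic to a direct summand of $R$ (regarded as a left $R$-module), and thus is, up to isomorphism, of the form $Re$ for some primitive idempotent $e$ of $R$.
   Context: A semiring $(R,+,\cdot,0_R,1_R)$: $(R,+,0_R)$ is a commutative monoid, $(R,\cdot,1_R)$ is a (not necessarily commutative) monoid, multiplication distributes over addition, and $0_Rr=r0_R=0_R$ (so that $R$ is a left module over itself). A (left) $R$-module $V$ is a commutative monoid $(V,+,0_V)$ with scalar multiplication $R\times V\to V$ such that $r(v+w)=rv+rw$, $(r_1+r_2)v=r_1v+r_2v$, $(r_1r_2)v=r_1(r_2v)$, $1_Rv=v$, and $0_Rv=r0_V=0_V$. $R$ lacks zero sums if $a+b=0_R$ implies $a=b=0_R$. For submodules $T,W$ of $V$, $V=T\oplus W$ means every element of $V$ is uniquely of the form $t+w$ with $t\in T$, $w\in W$; a direct summand of $V$ is a submodule $T$ such that $V=T\oplus W$ for some submodule $W$. A module $V\neq\{0_V\}$ is indecomposable if there is no decomposition $V=W_1\oplus W_2$ with $W_1\ne\{0_V\}$ and $W_2\neq\{0_V\}$. A module is projective if it is a direct summand of a free $R$-module (a direct sum of copies of $R$, possibly infinitely many). An element $e\in R$ is idempotent if $e^2=e$; idempotents $e,f$ are orthogonal if $ef=fe=0_R$; an idempotent is primitive if it cannot be written as the sum of two nonzero orthogonal idempotents. *)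

(* Defs.v *)
From HB Require Import structures.
From mathcomp Require Import all_boot all_algebra.
From mathcomp Require Import boolp classical_sets functions cardinality.

Set Implicit Arguments.
Unset Strict Implicit.
Unset Printing Implicit Defensive.

Import GRing.Theory.
Local Open Scope classical_set_scope.
Local Open Scope ring_scope.

Definition lacks_zero_sums (R : pzSemiRingType) : Prop :=
  forall a b : R, a + b = 0 -> a = 0 /\ b = 0.

Section Submodules.
Variables (R : pzSemiRingType) (V : lSemiModType R).

Definition submodule (U : set V) : Prop := GRing.subsemimod_closed [in U].

Definition direct_sum (T W : set V) : Prop :=
  [/\ submodule T, submodule W &
      forall v : V, exists! p : V * V, [/\ T p.1, W p.2 & v = p.1 + p.2]].

Definition direct_summand (T : set V) : Prop := exists W, direct_sum T W.

Definition indecomposable : Prop :=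
  (exists v : V, v <> 0) /\
  ~ exists W1 W2 : set V,
      [/\ direct_sum W1 W2, W1 <> [set 0] & W2 <> [set 0]].

Definition iso_to_submodule (P : lSemiModType R) (T : set V) : Prop :=
  exists f : {linear P -> V}, injective f /\ range f = T.

End Submodules.

(* The direct sum of copies of the left R-module R indexed by I, realised as
   the finitely supported functions I -> R. *)
Section FreeModule.
Variables (R : pzSemiRingType) (I : Type).

Definition finsupp_pred : {pred I -> R} :=
  fun f => `[< finite_set [set i | f i <> 0] >].

Record free_module := FreeModule {
  free_module_val :> I -> R;
  _ : finsupp_pred free_module_val
}.

HB.instance Definition _ := [isSub for free_module_val].
HB.instance Definition _ := [Choice of free_module by <:].

Lemma finsupp_nmod_closed : Algebra.nmod_closed finsupp_pred.
Proof.
split=> [|f g /asboolP ff /asboolP fg]; apply/asboolP.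
  by apply: (sub_finite_set _ (@finite_set0 I)) => i /=.
apply: (sub_finite_set _ (_ : finite_set ([set i | f i <> 0] `|`
                                          [set i | g i <> 0]))).
  move=> i /= fg0; apply: contrapT => /not_orP[/contrapT fi0 /contrapT gi0].
  by apply: fg0; rewrite /GRing.add /= fi0 gi0 addr0.
by rewrite finite_setU.
Qed.

HB.instance Definition _ :=
  GRing.SubChoice_isSubNmodule.Build (I -> R) finsupp_pred free_module
    finsupp_nmod_closed.

Lemma free_module0E i : (0 : free_module) i = 0.
Proof. exact: (congr1 (@^~ i) (raddf0 (val : free_module -> I -> R))). Qed.

Lemma free_moduleDE (f g : free_module) i : (f + g) i = f i + g i.
Proof.
exact: (congr1 (@^~ i) (raddfD (val : free_module -> I -> R) f g)).
Qed.

Lemma finsupp_scale (a : R) (f : free_module) :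
  finsupp_pred (fun i => a * f i).
Proof.
apply/asboolP; case: f => f /= /asboolP; apply: sub_finite_set => i /= afi0 fi0.
by apply: afi0; rewrite fi0 mulr0.
Qed.

Definition free_module_scale (a : R) (f : free_module) : free_module :=
  FreeModule (finsupp_scale a f).

Lemma free_module_scaleA a b f :
  free_module_scale a (free_module_scale b f) = free_module_scale (a * b) f.
Proof. by apply/val_inj/funext => i /=; rewrite mulrA. Qed.

Lemma free_module_scale0 f : free_module_scale 0 f = 0.
Proof.
by apply/val_inj/funext => i; rewrite [RHS]free_module0E; apply: mul0r.
Qed.

Lemma free_module_scale1 : left_id 1 free_module_scale.
Proof. by move=> f; apply/val_inj/funext => i /=; rewrite mul1r. Qed.

Lemma free_module_scaleDr : right_distributive free_module_scale +%R.
Proof.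
move=> a f g; apply/val_inj/funext => i.
rewrite [RHS]free_moduleDE; apply: etrans (mulrDr _ _ _).
exact: congr1 (free_moduleDE f g i).
Qed.

Lemma free_module_scaleDl f : {morph free_module_scale^~ f : a b / a + b}.
Proof.
move=> a b; apply/val_inj/funext => i.
by rewrite [RHS]free_moduleDE; apply: mulrDl.
Qed.

HB.instance Definition _ := GRing.Nmodule_isLSemiModule.Build R free_module
  free_module_scaleA free_module_scale0 free_module_scale1
  free_module_scaleDr free_module_scaleDl.

Lemma free_moduleZE (a : R) (f : free_module) i : (a *: f) i = a * f i.
Proof. by []. Qed.

End FreeModule.

Definition projective (R : pzSemiRingType) (P : lSemiModType R) : Prop :=
  exists (I : Type) (T : set (free_module R I)),
    direct_summand T /\ iso_to_submodule P T.

Section Idempotents.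
Variable R : pzSemiRingType.

Definition idempotent (e : R) : Prop := e * e = e.

Definition orthogonal (e f : R) : Prop := e * f = 0 /\ f * e = 0.

(* Nothing excludes e = 0, unlike in the usual ring-theoretic convention. *)
Definition primitive_idempotent (e : R) : Prop :=
  idempotent e /\
  ~ exists f g : R,
      [/\ idempotent f, idempotent g, f <> 0, g <> 0 &
          orthogonal f g /\ e = f + g].

Definition left_ideal_of (e : R) : set R^o := [set r * e | r in [set: R]].

End Idempotents.

(* Main.v *)
Require Import Defs.
From HB Require Import structures.
From mathcomp Require Import all_boot all_algebra.
From mathcomp Require Import boolp classical_sets functions cardinality.

(** If V lacks zero sums and V = T (+) W = A (+) B, then the T- and
    W-components of an element of A have B-components summing to 0, hence
    vanishing: A = (A n T) (+) (A n W), and consequently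
    T = (T n A) (+) (T n B).  Apply this to V free, T isomorphic to P, A the
    line spanned by a basis vector b_i and B the span of the other ones, where
    i is chosen so that T has an element with nonzero i-th coordinate.
    Indecomposability forces T n B = 0, so T is contained in A = R b_i, which
    it splits off as a summand.  A summand of R is R e, with e the component
    of 1, and a splitting e = f + g into orthogonal idempotents gives
    R e = R f (+) R g. *)

Set Implicit Arguments.
Unset Strict Implicit.
Unset Printing Implicit Defensive.

Import GRing.Theory.
Local Open Scope classical_set_scope.
Local Open Scope ring_scope.

(** * Direct sums of submodules and their components *)

Section Submodules.
Variables (R : pzSemiRingType) (V : lSemiModType R).
Implicit Types A B T U W : set V.

Lemma submoduleP U :
  submodule U <->
  [/\ U 0, forall u v, U u -> U v -> U (u + v) & forall a u, U u -> U (a *: u)].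
Proof.
split=> [[[]]|[U0 UD UZ]].
  rewrite in_setE => U0 UD UZ; split=> // [u v Uu Uv|a u Uu].
    by have := UD u v; rewrite !in_setE; apply.
  by have := UZ a u; rewrite !in_setE; apply.
split; first split; first by rewrite in_setE.
  by move=> u v; rewrite !in_setE; apply: UD.
by move=> a u; rewrite !in_setE; apply: UZ.
Qed.

(** The uniqueness half of a direct sum, kept apart so that it also applies to pairs that do not
    span [V], such as left ideals [R f] and [R g]. *)
Definition independent A B : Prop := forall a a' b b',
  A a -> A a' -> B b -> B b' -> a + b = a' + b' -> a = a' /\ b = b'.

Lemma direct_sumP A B :
  direct_sum A B <->
  [/\ submodule A, submodule B, independent A B &
      forall v, exists a b, [/\ A a, B b & v = a + b]].
Proof.
split=> [[sA sB AB]|[sA sB indAB AB]]; split=> //.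
- move=> a a' b b' Aa Aa' Bb Bb' e.
  have [p [_ up]] := AB (a + b).
  have := up (a, b) (And3 Aa Bb erefl); have := up (a', b') (And3 Aa' Bb' e).
  by move=> -> [-> ->].
- by move=> v; have [[a b] [[Aa Bb ->] _]] := AB v; exists a, b.
- move=> v; have [a [b [Aa Bb ->]]] := AB v; exists (a, b); split=> //.
  by case=> a' b' [/= Aa' Bb'] /indAB[]// -> ->.
Qed.

Lemma direct_sumC A B : direct_sum A B -> direct_sum B A.
Proof.
move=> /direct_sumP[sA sB indAB AB]; apply/direct_sumP; split=> //.
  move=> b b' a a' Bb Bb' Aa Aa'; rewrite [b + a]addrC [b' + a']addrC => e.
  by have [] := indAB _ _ _ _ Aa Aa' Bb Bb' e.
by move=> v; have [a [b [Aa Bb ->]]] := AB v; exists b, a; rewrite addrC.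
Qed.

Section LacksZeroSums.
Hypothesis V_lzs : forall u v : V, u + v = 0 -> u = 0 /\ v = 0.

Lemma direct_sum_sub A B t w :
  direct_sum A B -> A (t + w) -> A t /\ A w.
Proof.
move=> /direct_sumP[/submoduleP[_ AD _] /submoduleP[B0 BD _] indAB AB] Atw.
have [t1 [t2 [At1 Bt2 tE]]] := AB t; have [w1 [w2 [Aw1 Bw2 wE]]] := AB w.
(* Uniqueness for [(t + w) + 0 = (t1 + w1) + (t2 + w2)] gives [t2 + w2 = 0]. *)
have [|_ /esym/V_lzs[t20 w20]] := indAB _ _ _ _ Atw (AD _ _ At1 Aw1) B0
    (BD _ _ Bt2 Bw2); first by rewrite addr0 tE wE addrACA.
by rewrite tE wE t20 w20 !addr0.
Qed.

(** Split [t] along [A] and [B], then both parts along [T] and [W]. The [T]-parts add up to [t] by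
    uniqueness, and they stay in [A] and [B] by [direct_sum_sub]. *)
Lemma direct_sum_meet T W A B t : direct_sum T W -> direct_sum A B -> T t ->
  exists a b, [/\ (T `&` A) a, (T `&` B) b & t = a + b].
Proof.
move=> /direct_sumP[/submoduleP[_ TD _] /submoduleP[W0 WD _] indTW TW] dAB Tt.
have /direct_sumP[_ _ _ AB] := dAB; have [a [b [Aa Bb tE]]] := AB t.
have [a1 [a2 [Ta1 Wa2 aE]]] := TW a; have [b1 [b2 [Tb1 Wb2 bE]]] := TW b.
have [|tE' _] := indTW _ _ _ _ Tt (TD _ _ Ta1 Tb1) W0 (WD _ _ Wa2 Wb2).
  by rewrite addr0 tE aE bE addrACA.
have [|Aa1 _] := @direct_sum_sub A B a1 a2 dAB; first by rewrite -aE.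
have [|Bb1 _] := @direct_sum_sub B A b1 b2 (direct_sumC dAB).
  by rewrite -bE.
by exists a1, b1.
Qed.

End LacksZeroSums.

End Submodules.

(** The preimages of [A] and [B] under [f] decompose [P], so one of them is zero. Only the range of
    [f] is split by [A] and [B], which serves both for the axes of a free module and for left ideals
    inside [R e]. *)
Lemma indecomposable_embedding (R : pzSemiRingType) (P V : lSemiModType R)
    (f : {linear P -> V}) (A B : set V) :
  indecomposable P -> injective f ->
  submodule A -> submodule B -> independent A B ->
  (forall p, exists a b, [/\ (range f `&` A) a, (range f `&` B) b & f p = a + b]) ->
  (forall p, A (f p) -> p = 0) \/ (forall p, B (f p) -> p = 0).
Proof.
move=> [_ indecP] injf sA sB indAB AB.
have sub U : submodule U -> submodule (f @^-1` U).
  move=> /submoduleP[U0 UD UZ]; apply/submoduleP; split=> /= [|u v|a u].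
  - by rewrite linear0.
  - by rewrite linearD; apply: UD.
  - by rewrite linearZ; apply: UZ.
have trivial_or U : f @^-1` U = [set 0] -> forall p, U (f p) -> p = 0.
  by move=> U0 p Up; have : (f @^-1` U) p by []; rewrite U0.
have [/trivial_or|A0] := pselect (f @^-1` A = [set 0]); first by left.
right; apply: trivial_or; apply: contrapT => B0; apply: indecP.
exists (f @^-1` A), (f @^-1` B); split=> //.
apply/direct_sumP; split; [exact: sub|exact: sub| |].
  move=> a a' b b' /= Aa Aa' Bb Bb' /(congr1 f); rewrite !linearD => e.
  by have [/injf -> /injf ->] := indAB _ _ _ _ Aa Aa' Bb Bb' e.
move=> p; have [_ [_ [[[q _ <-] Aq] [[r _ <-] Br] e]]] := AB p.
by exists q, r; split=> //; apply: injf; rewrite linearD.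
Qed.

(** * Coordinates and axes of a free module *)

Section FreeModule.
Variables (R : pzSemiRingType) (I : Type).
Implicit Types f g : free_module R I.

Lemma free_moduleP f g : f =1 g -> f = g.
Proof. by move=> fg; apply/val_inj/funext. Qed.

Lemma free_module_lacks_zero_sums f g :
  lacks_zero_sums R -> f + g = 0 -> f = 0 /\ g = 0.
Proof.
move=> R_lzs fg0; suff fg i : f i = 0 /\ g i = 0.
  by split; apply: free_moduleP => i; rewrite free_module0E; case: (fg i).
by apply: R_lzs; rewrite -free_moduleDE fg0 free_module0E.
Qed.

Definition coord i f : R^o := f i.

Lemma coord_is_semilinear i : semilinear (coord i).
Proof.
by split=> [a f|f g]; rewrite /coord ?free_moduleZE ?free_moduleDE.
Qed.

HB.instance Definition _ i := GRing.isSemilinear.Build R (free_module R I) R^o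
  _ (coord i) (coord_is_semilinear i).

Lemma finsupp_delta i (x : R) :
  finsupp_pred (fun j : I => if `[< j = i >] then x else 0).
Proof.
apply/asboolP/(sub_finite_set _ (finite_set1 i)) => j /=.
by case: asboolP.
Qed.

Definition delta i (x : R) : free_module R I := FreeModule (finsupp_delta i x).

Lemma coord_delta i x : coord i (delta i x) = x.
Proof. by rewrite /coord /=; case: asboolP. Qed.

Lemma delta_neq i j x : j <> i -> delta i x j = 0.
Proof. by rewrite /=; case: asboolP. Qed.

Lemma delta_coord i f : (forall j, j <> i -> f j = 0) -> f = delta i (coord i f).
Proof.
move=> f0; apply: free_moduleP => j /=.
by case: asboolP => [->//|/f0].
Qed.

Lemma deltaD i x y : delta i (x + y) = delta i x + delta i y.
Proof.
by apply: free_moduleP => j; rewrite free_moduleDE /=; case: asboolP; rewrite ?addr0.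
Qed.

Lemma delta0 i : delta i 0 = 0.
Proof. by apply: free_moduleP => j; rewrite free_module0E /=; case: asboolP. Qed.

Lemma deltaZ i a x : delta i (a * x) = a *: delta i x.
Proof.
by apply: free_moduleP => j; rewrite free_moduleZE /=; case: asboolP; rewrite ?mulr0.
Qed.

(** The line spanned by the basis vector [delta i 1], given by equations so that membership is
    checked coordinatewise. *)
Definition axis i : set (free_module R I) :=
  [set f | forall j, j <> i -> f j = 0].

Definition coaxis i : set (free_module R I) := [set f | f i = 0].

Lemma finsupp_erase i f : finsupp_pred (fun j : I => if `[< j = i >] then 0 else f j).
Proof.
case: f => f /= /asboolP fin_f; apply/asboolP/(sub_finite_set _ fin_f) => j /=.
by case: asboolP.
Qed.

Lemma direct_sum_axis i : direct_sum (axis i) (coaxis i).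
Proof.
apply/direct_sumP; split.
- apply/submoduleP; split=> [j _|f g f0 g0 j ji|a f f0 j ji].
  + exact: free_module0E.
  + by rewrite free_moduleDE f0// g0// addr0.
  + by rewrite free_moduleZE f0// mulr0.
- apply/submoduleP; split=> [|f g f0 g0|a f f0]; rewrite /coaxis /mkset.
  + exact: free_module0E.
  + by rewrite free_moduleDE f0 g0 addr0.
  + by rewrite free_moduleZE f0 mulr0.
- move=> f f' g g' f0 f'0 g0 g'0 e.
  have ej j : f j + g j = f' j + g' j by rewrite -!free_moduleDE e.
  split; apply: free_moduleP => j; have := ej j; have [->|ji] := pselect (j = i).
  + by rewrite g0 g'0 !addr0.
  + by rewrite f0// f'0.
  + by rewrite g0 g'0.
  + by rewrite f0// f'0// !add0r.
- move=> f; exists (delta i (coord i f)), (FreeModule (finsupp_erase i f)).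
  split; [by move=> j; apply: delta_neq|by rewrite /coaxis /=; case: asboolP|].
  apply: free_moduleP => j; rewrite free_moduleDE /=.
  by case: asboolP => [->|_]; rewrite ?addr0 ?add0r.
Qed.

End FreeModule.

(** * From a summand of a free module to [R e] *)

Section Projective.
Variables (R : pzSemiRingType) (P : lSemiModType R).

Lemma indecomposable_projective_summand :
  lacks_zero_sums R -> indecomposable P -> projective P ->
  exists T : set R^o, direct_summand T /\ iso_to_submodule P T.
Proof.
move=> R_lzs indecP [I [T [[W dTW] [f [injf rfT]]]]].
have F_lzs (u v : free_module R I) : u + v = 0 -> u = 0 /\ v = 0.
  exact: free_module_lacks_zero_sums.
have /direct_sumP[/submoduleP[T0 TD TZ] /submoduleP[W0 WD WZ] indTW TW] := dTW.
have [[p p_neq0] _] := indecP.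
(* Otherwise [f p = 0], and injectivity gives [p = 0]. *)
have [i fpi] : exists i, coord i (f p) <> 0.
  apply: contrapT => fp0; apply: p_neq0; apply: injf; rewrite linear0.
  apply: free_moduleP => i; rewrite free_module0E; apply: contrapT => fpi.
  by apply: fp0; exists i.
have dA := direct_sum_axis R i.
have /direct_sumP[sA sC indAC AC] := dA.
have splitf q : exists a b, [/\ (range f `&` axis i) a,
    (range f `&` coaxis i) b & f q = a + b].
  by rewrite rfT; apply: direct_sum_meet dTW dA _ => //; rewrite -rfT; exists q.
have coaxis0 q : coaxis i (f q) -> q = 0.
  (* The first alternative kills the axis part of [f p], contradicting the choice of [i]. *)
  have [A0|] := indecomposable_embedding indecP injf sA sC indAC splitf;
    last exact.
  have [_ [b [[[r _ <-] /A0 ->] [_ Cb] e]]] := splitf p.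
  by case: fpi; rewrite e linear0 add0r; exact: Cb.
have Taxis t : T t -> axis i t.
  rewrite -rfT => -[q _ <-].
  have [a [_ [[_ Aa] [[r _ <-] /coaxis0 ->] ->]]] := splitf q.
  by rewrite linear0 addr0.
(* On the axis [delta i] inverts [coord i], and [f] takes its values there, so [h] is still
   injective. *)
pose h : {linear P -> R^o} := coord i \o f.
have deltah q : @delta R I i (h q) = f q.
  by apply/esym/delta_coord/Taxis; rewrite -rfT; exists q.
have rhP x : range h x <-> T (@delta R I i x).
  split=> [[q _ <-]|]; first by rewrite deltah -rfT; exists q.
  by rewrite -rfT => -[q _ fq]; exists q => //; rewrite /h /= fq coord_delta.
exists (range h); split; last first.
  exists h; split=> // q r hqr; apply: injf.
  by rewrite -[LHS]deltah hqr deltah.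
(* The complement is the intersection of [W] with the axis, carried over to [R]. *)
exists [set x | W (@delta R I i x)]; apply/direct_sumP; split.
- apply/submoduleP; split=> [|u v /rhP Tu /rhP Tv|a u /rhP Tu]; apply/rhP.
  + by rewrite delta0.
  + by rewrite deltaD; apply: TD.
  + by rewrite deltaZ; apply: TZ.
- apply/submoduleP; split=> /= [|u v Wu Wv|a u Wu].
  + by rewrite delta0.
  + by rewrite deltaD; apply: WD.
  + by rewrite deltaZ; apply: WZ.
- move=> t t' w w' /rhP Tt /rhP Tt' /= Ww Ww' /(congr1 (@delta R I i)).
  rewrite !deltaD => /(indTW _ _ _ _ Tt Tt' Ww Ww').
  by move=> [/(congr1 (coord i)) + /(congr1 (coord i))]; rewrite !coord_delta.
- move=> x; have [t [w [Tt Ww e]]] := TW (@delta R I i x).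
  (* Since [t + w] lies on the axis, so do [t] and [w]; their coordinates then determine them. *)
  have [|At Aw] := @direct_sum_sub _ _ F_lzs _ _ t w dA.
    by rewrite -e => j; apply: delta_neq.
  exists (coord i t), (coord i w); split.
  + by apply/rhP; rewrite -delta_coord.
  + by rewrite /= -delta_coord.
  + by rewrite -raddfD -e; apply/esym/coord_delta.
Qed.

Lemma direct_summand_left_ideal (T : set R^o) :
  direct_summand T -> exists e, Defs.idempotent e /\ T = left_ideal_of e.
Proof.
move=> [W /direct_sumP[/submoduleP[T0 _ TZ] /submoduleP[W0 _ WZ] indTW TW]].
have [e [f [Te Wf ef]]] := TW 1.
(* Uniqueness for [t * e + t * f = t + 0], where [1 = e + f]. *)
have TeE t : T t -> t * e = t.
  move=> Tt; have [|] := indTW (t * e) t (t * f) 0 (TZ t e Te) Tt (WZ t f Wf) W0.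
  - by rewrite -mulrDr -ef addr0; apply: mulr1.
  - by [].
exists e; split; first exact: TeE.
apply/seteqP; split=> [t /TeE te|_ [r _ <-]]; first by exists t.
exact: TZ.
Qed.

Lemma submodule_left_ideal (e : R) : submodule (left_ideal_of e).
Proof.
apply/submoduleP; split.
- by exists 0 => //; rewrite mul0r.
- by move=> _ _ [r _ <-] [s _ <-]; exists (r + s) => //; rewrite mulrDl.
- by move=> a _ [r _ <-]; exists (a * r) => //; rewrite -mulrA.
Qed.

(** Right multiplication by [f] fixes [R f] and kills [R g], so it recovers the first component; [g]
    recovers the second. *)
Lemma independent_left_ideal (f g : R) :
  Defs.idempotent f -> Defs.idempotent g -> Defs.orthogonal f g ->
  independent (left_ideal_of f) (left_ideal_of g).
Proof.
move=> ff gg [fg gf] _ _ _ _ [a _ <-] [a' _ <-] [b _ <-] [b' _ <-] e.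
split.
- move: (congr1 (fun x : R => x * f) e).
  by rewrite !mulrDl -!mulrA ff gf !mulr0 !addr0.
- move: (congr1 (fun x : R => x * g) e).
  by rewrite !mulrDl -!mulrA gg fg !mulr0 !add0r.
Qed.

(** A splitting [e = f + g] decomposes [R e] into [R f] and [R g], so [indecomposable_embedding]
    would make one of them trivial. *)
Lemma indecomposable_primitive (e : R) :
  indecomposable P -> Defs.idempotent e ->
  iso_to_submodule P (left_ideal_of e) -> primitive_idempotent e.
Proof.
move=> indecP ee [h [injh rh]]; split=> // -[f [g [ff gg f0 g0 [ofg efg]]]].
have [fg gf] := ofg.
have fe : f * e = f by rewrite efg mulrDr ff fg addr0.
have ge : g * e = g by rewrite efg mulrDr gg gf add0r.
have mem x : x * e = x -> range h x by move=> xe; rewrite rh; exists x.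
have memZ r x : x * e = x -> range h (r * x).
  by move=> xe; apply: mem; rewrite -mulrA xe.
(* The witness is [x = 1 * x] itself, which lies in the range of [h]. *)
have nontrivial x : x <> 0 -> x * e = x ->
    ~ forall p, left_ideal_of x (h p) -> p = 0.
  move=> x0 /mem[p _ hp] hx; apply: x0; rewrite -hp (hx p) ?linear0// hp.
  by exists 1 => //; rewrite mul1r.
have [p||] := indecomposable_embedding indecP injh (submodule_left_ideal f)
    (submodule_left_ideal g) (independent_left_ideal ff gg ofg).
- have : left_ideal_of e (h p) by rewrite -rh; exists p.
  move=> [r _ <-]; exists (r * f), (r * g); split.
  + by split; [exact: memZ|exists r].
  + by split; [exact: memZ|exists r].
  + by rewrite efg mulrDr.
- exact: nontrivial.
- exact: nontrivial.
Qed.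

End Projective.

Theorem theorem3p2 (R : pzSemiRingType) (P : lSemiModType R) :
  lacks_zero_sums R -> indecomposable P -> projective P ->
  (exists T : set R^o, direct_summand T /\ iso_to_submodule P T) /\
  (exists e : R, primitive_idempotent e /\ iso_to_submodule P (left_ideal_of e)).
Proof.
move=> R_lzs indecP projP.
have [T [dT isoT]] := indecomposable_projective_summand R_lzs indecP projP.
split; first by exists T.
have [e [ee TE]] := direct_summand_left_ideal dT; rewrite TE in isoT.
by exists e; split=> //; apply: indecomposable_primitive isoT.
Qed.
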